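(* (a) The left peak number $\mathrm{lpk}$ is shuffle-compatible. (b) The linear map on $\mathcal{A}_{\mathrm{lpk}}$ defined by $[\pi]_{\mathrm{lpk}}\mapsto\frac{2^{2\mathrm{lpk}(\pi)}t^{\mathrm{lpk}(\pi)}(1+t)^{|\pi|-2\mathrm{lpk}(\pi)}}{(1-t)^{|\pi|+1}}x^{|\pi|}$ if $|\pi|\ge1$ and $[\pi]_{\mathrm{lpk}}\mapsto1/(1-t)$ if $|\pi|=0$ is a $\mathbb{Q}$-algebra isomorphism from $\mathcal{A}_{\mathrm{lpk}}$ to the span of $\{\frac1{1-t}\}\cup\{\frac{2^{2j}t^j(1+t)^{n-2j}}{(1-t)^{n+1}}x^n\}_{n\ge1,\,0\le j\le\lfloor n/2\rfloor}$, a subalgebra of $\mathbb{Q}[[t*]][x]$. (c) The $n$th homogeneous component of $\mathcal{A}_{\mathrm{lpk}}$ has dimension $\lfloor n/2\rfloor+1$.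
   Context: A permutation of length $n$ is a sequence $\pi=\pi_1\cdots\pi_n$ of distinct positive integers. A peak is an index $2\le i\le n-1$ with $\pi_{i-1}<\pi_i>\pi_{i+1}$; a left peak is an $i\in[n-1]$ that is a peak or is $i=1$ with $\pi_1>\pi_2$; $\mathrm{lpk}(\pi)$ is the number of left peaks. For disjoint permutations, $S(\pi,\sigma)$ is the set of shuffles (permutations of length $|\pi|+|\sigma|$ containing both as subsequences). A statistic $\mathrm{st}$ is shuffle-compatible if for disjoint $\pi,\sigma$ the multiset $\{\mathrm{st}(\tau):\tau\in S(\pi,\sigma)\}$ depends only on $\mathrm{st}(\pi),\mathrm{st}(\sigma),|\pi|,|\sigma|$; its shuffle algebra $\mathcal{A}_{\mathrm{st}}$ has basis the classes $[\pi]_{\mathrm{st}}$ of permutations with equal length and $\mathrm{st}$-value, product $[\pi]_{\mathrm{st}}[\sigma]_{\mathrm{st}}=\sum_{\tau\in S(\pi,\sigma)}[\tau]_{\mathrm{st}}$, graded by length. $\mathbb{Q}[[t*]][x]$ denotes polynomials in $x$ with coefficients formal power series in $t$, with multiplication ordinary in $x$ and the Hadamard product $(\sum a_nt^n)*(\sum b_nt^n)=\sum a_nb_nt^n$ in $t$. *)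

(* Defs.v *)
From HB Require Import structures.
From mathcomp Require Import all_boot all_order all_algebra.
From mathcomp Require Import finmap.
From mathcomp Require Import boolp classical_sets functions.
From mathcomp Require Import monalg.

Set Implicit Arguments.
Unset Strict Implicit.
Unset Printing Implicit Defensive.

Import GRing.Theory.

Local Open Scope quotient_scope.
Local Open Scope classical_set_scope.
Local Open Scope ring_scope.

Record permutation := Permutation {
  letters :> seq nat;
  _ : uniq letters && all [pred a | 0 < a]%N letters
}.

HB.instance Definition _ := [isSub for letters].
HB.instance Definition _ := [Choice of permutation by <:].

Implicit Types pi sigma rho tau : permutation.

Definition disjoint_perm pi sigma : bool := ~~ has [in (pi : seq nat)] sigma.

(* For disjoint [pi] and [sigma], a permutation of length [|pi| + |sigma|]
   having both as subsequences is a rearrangement of [pi ++ sigma]; this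
   reduces the set of shuffles to a finite duplicate-free enumeration,
   see [mem_shuffles] and [shuffles_uniq]. *)
Definition shuffles pi sigma : seq permutation :=
  pmap insub [seq s <- permutations (pi ++ sigma) | subseq pi s & subseq sigma s].

Definition same_order pi sigma : Prop :=
  size pi = size sigma /\
  forall i j, (i < size pi)%N -> (j < size pi)%N ->
    (nth 0 pi i < nth 0 pi j)%N = (nth 0 sigma i < nth 0 sigma j)%N.

(* A permutation statistic depends only on the relative order of the letters.
   This is what makes every pair of classes have disjoint representatives. *)
Record statistic (T : eqType) := Statistic {
  stat_val :> permutation -> T;
  stat_same_order : forall pi sigma,
    same_order pi sigma -> stat_val pi = stat_val sigma
}.

(* Multisets are compared as sequences up to rearrangement. *)
Definition shuffle_compatible (T : eqType) (st : statistic T) : Prop :=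
  forall pi sigma pi' sigma',
    disjoint_perm pi sigma -> disjoint_perm pi' sigma' ->
    size pi = size pi' -> size sigma = size sigma' ->
    st pi = st pi' -> st sigma = st sigma' ->
    perm_eq [seq st tau | tau <- shuffles pi sigma]
            [seq st tau | tau <- shuffles pi' sigma'].

(* Positions are counted from 1. *)
Definition letter pi (i : nat) : nat := nth 0%N pi i.-1.

Definition is_peak pi (i : nat) : bool :=
  [&& (2 <= i <= (size pi).-1)%N, (letter pi i.-1 < letter pi i)%N
    & (letter pi i.+1 < letter pi i)%N].

Definition is_left_peak pi (i : nat) : bool :=
  (1 <= i <= (size pi).-1)%N &&
  (is_peak pi i || (i == 1%N) && (letter pi 2 < letter pi 1)%N).

Definition lpk_val pi : nat := count (is_left_peak pi) (iota 1 (size pi).-1).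

Fact lpk_same_order pi sigma : same_order pi sigma -> lpk_val pi = lpk_val sigma.
Proof.
case=> eqsz eqlt; rewrite /lpk_val -eqsz; apply: eq_in_count => i.
rewrite mem_iota add1n; case: i => //= i ilt.
have {}ilt: (i.+1 < size pi)%N by case: (size pi) ilt.
have letE j k : (j < size pi)%N -> (k < size pi)%N ->
    (nth 0 sigma j < nth 0 sigma k)%N = (nth 0 pi j < nth 0 pi k)%N.
  by move=> *; rewrite eqlt.
have i1 : (i.-1 < size pi)%N by exact: leq_ltn_trans (leq_pred i) (ltnW ilt).
have n1 : (1 < size pi)%N by exact: leq_ltn_trans ilt.
rewrite /is_left_peak /is_peak /letter -eqsz /=.
by rewrite !letE // ltnW.
Qed.

Definition lpk : statistic nat := Statistic lpk_same_order.

Lemma perm_uniq_letters pi : uniq pi.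
Proof. by case: pi => s /= /andP[]. Qed.

Lemma shuffles_uniq pi sigma : uniq (shuffles pi sigma).
Proof. exact/pmap_sub_uniq/filter_uniq/permutations_uniq. Qed.

Lemma mem_shuffles pi sigma tau : disjoint_perm pi sigma ->
  (tau \in shuffles pi sigma) =
    [&& size tau == (size pi + size sigma)%N, subseq pi tau & subseq sigma tau].
Proof.
move=> dj; rewrite mem_pmap_sub mem_filter mem_permutations andbC /=.
apply/andP/and3P => [[p /andP[s1 s2]]|[/eqP sz s1 s2]].
  by rewrite s1 s2 (perm_size p) size_cat eqxx.
rewrite s1 s2; split=> //; rewrite perm_sym.
have U : uniq (pi ++ sigma).
  by rewrite cat_uniq !perm_uniq_letters /= andbT.
have sub : {subset (pi ++ sigma) <= (tau : seq nat)}.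
  by move=> x; rewrite mem_cat => /orP[]; apply: mem_subseq.
apply: uniq_perm; rewrite ?perm_uniq_letters //.
have le : (size tau <= size (pi ++ sigma))%N by rewrite size_cat sz.
by case: (uniq_min_size U sub le).
Qed.

Lemma disjoint_permC pi sigma : disjoint_perm pi sigma = disjoint_perm sigma pi.
Proof. by rewrite /disjoint_perm has_sym. Qed.

Lemma shufflesC pi sigma : disjoint_perm pi sigma ->
  perm_eq (shuffles pi sigma) (shuffles sigma pi).
Proof.
move=> dj; apply: uniq_perm; rewrite ?shuffles_uniq // => tau.
have dj' : disjoint_perm sigma pi by rewrite disjoint_permC.
by rewrite !mem_shuffles // addnC [subseq pi _ && _]andbC.
Qed.

Lemma mem_of_shuffle pi sigma tau : tau \in shuffles pi sigma ->
  (tau : seq nat) =i pi ++ sigma.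
Proof.
rewrite mem_pmap_sub mem_filter mem_permutations => /andP[_ p].
exact: perm_mem.
Qed.

Lemma disjoint_perm_shuffle pi sigma rho tau : tau \in shuffles pi sigma ->
  disjoint_perm pi rho -> disjoint_perm sigma rho -> disjoint_perm tau rho.
Proof.
move=> /mem_of_shuffle E d1 d2; rewrite /disjoint_perm.
rewrite (eq_has (a2 := [in (pi ++ sigma)])); last by move=> x; rewrite /= E.
rewrite (eq_has (a2 := predU [in (pi : seq nat)] [in (sigma : seq nat)])).
  by rewrite has_predU negb_or; apply/andP.
by move=> x; rewrite /= mem_cat.
Qed.

Lemma subperm_proof (a : pred nat) pi :
  uniq (filter a pi) && all [pred b | 0 < b]%N (filter a pi).
Proof.
case: pi => s /= /andP[us /allP ps]; rewrite filter_uniq //=.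
by apply/allP => x; rewrite mem_filter => /andP[_ /ps].
Qed.

Definition subperm (a : pred nat) pi : permutation := Permutation (subperm_proof a pi).

Lemma mem_shuffles3 pi sigma rho omega :
  disjoint_perm pi sigma -> disjoint_perm pi rho -> disjoint_perm sigma rho ->
  (omega \in [seq w | tau <- shuffles pi sigma, w <- shuffles tau rho]) =
    [&& size (omega : permutation) == (size pi + size sigma + size rho)%N,
      subseq pi omega, subseq sigma omega & subseq rho omega].
Proof.
move=> d1 d2 d3; apply/allpairsPdep/and4P.
  move=> [tau [w [ttau + ->]]] {omega}.
  rewrite mem_shuffles ?(disjoint_perm_shuffle ttau) // => /and3P[/eqP-> st ->].
  move: ttau; rewrite mem_shuffles // => /and3P[/eqP-> s1 s2].
  by rewrite eqxx (subseq_trans s1 st) (subseq_trans s2 st).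
move=> [/eqP sz s1 s2 s3].
pose tau := subperm [in pi ++ sigma] omega; exists tau, omega.
have ttau : tau \in shuffles pi sigma.
  rewrite mem_shuffles // !subseq_filter s1 s2 !andbT.
  have U : uniq (pi ++ sigma) by rewrite cat_uniq !perm_uniq_letters /= andbT.
  have -> /= : all [in pi ++ sigma] pi.
    by apply/allP => x /=; rewrite mem_cat => ->.
  have -> /= : all [in pi ++ sigma] sigma.
    by apply/allP => x /=; rewrite mem_cat => ->; rewrite orbT.
  rewrite andbT -size_cat; apply/eqP/perm_size/uniq_perm => //.
    exact: perm_uniq_letters tau.
  move=> x; rewrite mem_filter /=; case: (boolP (x \in _)) => //= + .
  by rewrite mem_cat => /orP[]; apply: mem_subseq.
split=> //; rewrite mem_shuffles ?(disjoint_perm_shuffle ttau) //.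
rewrite s3 filter_subseq sz /= andbT.
by move: ttau; rewrite mem_shuffles // => /andP[/eqP->].
Qed.

Lemma uniq_shuffles3 pi sigma rho :
  disjoint_perm pi sigma -> disjoint_perm pi rho -> disjoint_perm sigma rho ->
  uniq [seq w | tau <- shuffles pi sigma, w <- shuffles tau rho].
Proof.
move=> d1 d2 d3; apply: allpairs_uniq_dep; rewrite ?shuffles_uniq //.
  by move=> *; rewrite shuffles_uniq.
move=> _ _ /allpairsPdep[t [w [ht hw ->]]] /allpairsPdep[t' [w' [ht' hw' ->]]] /=.
move=> E; rewrite -{w'}E in hw' *; suff -> : t = t' by [].
have memE := mem_of_shuffle ht; have memE' := mem_of_shuffle ht'.
move: hw hw'; rewrite !mem_shuffles ?(disjoint_perm_shuffle ht) //.
  2: by rewrite ?(disjoint_perm_shuffle ht').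
move=> /and3P[_ /(subseq_uniqP (perm_uniq_letters w)) E _].
move=> /and3P[_ /(subseq_uniqP (perm_uniq_letters w)) E' _].
apply: val_inj => /=; rewrite E E'; apply: eq_filter => x.
by rewrite /= memE memE'.
Qed.

Lemma shufflesA pi sigma rho :
  disjoint_perm pi sigma -> disjoint_perm pi rho -> disjoint_perm sigma rho ->
  perm_eq [seq w | tau <- shuffles pi sigma, w <- shuffles tau rho]
          [seq w | tau <- shuffles sigma rho, w <- shuffles tau pi].
Proof.
move=> d1 d2 d3.
have [d2' d1'] : disjoint_perm rho pi /\ disjoint_perm sigma pi.
  by rewrite ![disjoint_perm _ pi]disjoint_permC.
apply: uniq_perm; rewrite ?uniq_shuffles3 // => w.
rewrite !mem_shuffles3 // -!addnA [(size pi + _)%N]addnC !addnA.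
by case: (_ == _); case: (subseq pi _); rewrite //= ?andbT ?andbF.
Qed.

Fact nil_perm_proof : uniq (Nil nat) && all [pred a | 0 < a]%N (Nil nat).
Proof. by []. Qed.

Definition nil_perm : permutation := Permutation nil_perm_proof.

Lemma shuffles_nil pi : shuffles nil_perm pi = [:: pi].
Proof.
apply: perm_small_eq => //; apply: uniq_perm; rewrite ?shuffles_uniq // => tau.
rewrite mem_shuffles; last by rewrite /disjoint_perm has_pred0.
rewrite sub0seq inE /= add0n; apply/andP/eqP => [[/eqP sz s]|->//].
by apply: val_inj => /=; apply/esym/eqP; rewrite -size_subseq_leqif // sz.
Qed.

Definition max_letter pi : nat := \max_(a <- pi) a.

Fact shift_perm_proof m pi :
  uniq [seq (m + a)%N | a <- pi] &&
  all [pred a | 0 < a]%N [seq (m + a)%N | a <- pi].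
Proof.
case: pi => s /= /andP[us /allP ps]; rewrite map_inj_uniq ?us //=; last exact: addnI.
by apply/allP => _ /mapP[x /ps px ->] /=; rewrite ltn_addl.
Qed.

Definition shift_perm m pi : permutation := Permutation (shift_perm_proof m pi).

Lemma shift_perm_same_order m pi : same_order (shift_perm m pi) pi.
Proof.
split=> [|i j]; rewrite /= size_map // => ilt jlt.
by rewrite !(nth_map 0%N) // ltn_add2l.
Qed.

Lemma disjoint_shift pi sigma m : (max_letter pi <= m)%N ->
  disjoint_perm pi (shift_perm m sigma).
Proof.
move=> le; apply/hasPn => _ /mapP[x xs ->] /=; apply/negP => inpi.
have x0 : (0 < x)%N by case: sigma xs => s /= /andP[_ /allP]; apply.
have : (m + x <= max_letter pi)%N by exact: (@leq_bigmax_seq _ _ xpredT id (m + x)%N).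
by rewrite leqNgt (leq_ltn_trans le) // -[ltnLHS]addn0 ltn_add2l.
Qed.

Lemma statE (T : eqType) (st : statistic T) m pi : st (shift_perm m pi) = st pi.
Proof. exact/stat_same_order/shift_perm_same_order. Qed.

Section LinearExtension.
Variables (K : choiceType) (V : lmodType rat) (f : K -> V).

Definition linext (a : {malg rat[K]}) : V := \sum_(k <- msupp a) a@_k *: f k.

Lemma linextEw (d : {fset K}) a : (msupp a `<=` d)%fset ->
  linext a = \sum_(k <- d) a@_k *: f k.
Proof.
move=> sub; rewrite /linext (big_fset_incl _ sub) // => k _ /mcoeff_outdom->.
by rewrite scale0r.
Qed.

Fact linext_is_linear : linear linext.
Proof.
move=> c a b; set d := (msupp a `|` msupp b)%fset.
have sab : (msupp (c *: a + b) `<=` d)%fset.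
  apply: fsubset_trans (msuppD_le _ _) _.
  exact: (fsetSU _ (msuppZ_le _ _)).
rewrite (linextEw sab) (linextEw (fsubsetUl _ _ : (msupp a `<=` d)%fset)).
rewrite (linextEw (fsubsetUr _ _ : (msupp b `<=` d)%fset)) scaler_sumr -big_split.
by apply: eq_bigr => k _; rewrite mcoeffD mcoeffZ scalerDl scalerA.
Qed.

HB.instance Definition _ :=
  GRing.isLinear.Build rat {malg rat[K]} V *:%R linext linext_is_linear.

Lemma linextU k : linext << k >> = f k.
Proof.
by rewrite /linext msuppU oner_eq0 big_seq_fset1 mcoeffUU scale1r.
Qed.

End LinearExtension.

Lemma malg_linear_ext (K : choiceType) (V : lmodType rat)
    (f g : {malg rat[K]} -> V) :
  linear f -> linear g -> (forall k, f << k >> = g << k >>) -> f =1 g.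
Proof.
move=> lf lg fg a.
pose F : {linear {malg rat[K]} -> V} :=
  HB.pack f (GRing.isLinear.Build rat {malg rat[K]} V *:%R f lf).
pose G : {linear {malg rat[K]} -> V} :=
  HB.pack g (GRing.isLinear.Build rat {malg rat[K]} V *:%R g lg).
rewrite -[f a]/(F a) -[g a]/(G a) [a]monalgE !linear_sum.
apply: eq_bigr => k _; have -> : << a@_k *g k >> = a@_k *: << k >> :> {malg rat[K]}.
  by apply/malgP => l; rewrite mcoeffZ !mcoeffU mulrnAr mulr1.
by rewrite !linearZ /= fg.
Qed.

Section ShuffleAlgebra.
Variables (T : eqType) (st : statistic T).

Definition st_equiv : rel permutation :=
  fun pi sigma => (size pi == size sigma) && (st pi == st sigma).

Fact st_equiv_is_equiv : equiv_class_of st_equiv.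
Proof.
split=> [pi|pi sigma|sigma pi rho] /=; rewrite /st_equiv ?eqxx //.
  by rewrite eq_sym [st pi == _]eq_sym.
by move=> /andP[/eqP-> /eqP->].
Qed.

Canonical st_equiv_equiv_rel := EquivRelPack st_equiv_is_equiv.

Definition st_class := {eq_quot st_equiv}.
HB.instance Definition _ := Choice.on st_class.
HB.instance Definition _ := EqQuotient.on st_class.

Lemma st_classP pi sigma :
  (\pi_st_class pi = \pi_st_class sigma) <-> size pi = size sigma /\ st pi = st sigma.
Proof.
split=> [/eqmodP /andP[/eqP ? /eqP ?] //|[e1 e2]].
by apply/eqmodP; rewrite /= /st_equiv e1 e2 !eqxx.
Qed.

(* The product of two classes is read off from one pair of disjoint
   representatives; for a shuffle-compatible statistic it does not depend on
   this pair, see [class_mulE]. *)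
Definition class_mul (k l : st_class) : {malg rat[st_class]} :=
  let pi := repr k in
  \sum_(tau <- shuffles pi (shift_perm (max_letter pi) (repr l)))
    << \pi_st_class tau >>.

Definition shuffle_mul (a b : {malg rat[st_class]}) : {malg rat[st_class]} :=
  linext (fun k => linext (class_mul k) b) a.

Fact coef_sum_class (N : nat) (s : seq permutation) rho :
  {in s, forall tau, size tau = N} ->
  (\sum_(tau <- s) (<< \pi_st_class tau >> : {malg rat[st_class]}))@_(\pi_st_class rho)
    = (if size rho == N then count_mem (st rho) [seq st tau | tau <- s] else 0%N)%:R.
Proof.
move=> sN; rewrite raddf_sum /= count_map -sum1_count.
under eq_big_seq => tau hs do rewrite mcoeffU eqmodE /= /st_equiv (sN _ hs) eq_sym.
case: (_ == N) => /=; last by rewrite big1.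
by rewrite natr_sum [RHS]big_mkcond; apply: eq_bigr => tau _ /=; case: (_ == _).
Qed.

Fact eq_sum_class (N : nat) (s s' : seq permutation) :
  {in s, forall tau, size tau = N} -> {in s', forall tau, size tau = N} ->
  perm_eq [seq st tau | tau <- s] [seq st tau | tau <- s'] ->
  \sum_(tau <- s) (<< \pi_st_class tau >> : {malg rat[st_class]})
    = \sum_(tau <- s') << \pi_st_class tau >>.
Proof.
move=> sN s'N /permP e; apply/malgP; elim/quotW => rho.
by rewrite !(coef_sum_class (N := N)) // e.
Qed.

Hypothesis st_compat : shuffle_compatible st.

Lemma class_mulE pi sigma : disjoint_perm pi sigma ->
  class_mul (\pi_st_class pi) (\pi_st_class sigma) =
  \sum_(tau <- shuffles pi sigma) << \pi_st_class tau >>.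
Proof.
move=> dj; rewrite /class_mul; set pi' := repr _; set sigma' := shift_perm _ _.
have dj' : disjoint_perm pi' sigma' by apply: disjoint_shift.
have [sz e] : size pi' = size pi /\ st pi' = st pi.
  by apply/st_classP; rewrite /pi' reprK.
have [sz' e'] : size sigma' = size sigma /\ st sigma' = st sigma.
  rewrite statE /sigma' /= size_map.
  by apply/st_classP; rewrite reprK.
apply: (eq_sum_class (N := (size pi + size sigma)%N)).
- by move=> tau; rewrite mem_shuffles // sz sz' => /and3P[/eqP].
- by move=> tau; rewrite mem_shuffles // => /and3P[/eqP].
- exact: st_compat.
Qed.

Fact disjoint_reprs (k l m : st_class) : exists pi sigma rho,
  [/\ [/\ disjoint_perm pi sigma, disjoint_perm pi rho & disjoint_perm sigma rho],
      k = \pi_st_class pi, l = \pi_st_class sigma & m = \pi_st_class rho].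
Proof.
elim/quotW: k => pi; elim/quotW: l => sigma; elim/quotW: m => rho.
pose sigma' := shift_perm (max_letter pi) sigma.
pose rho' := shift_perm (max_letter pi + max_letter sigma') rho.
exists pi, sigma', rho'; split=> //; first by split; apply: disjoint_shift;
  rewrite ?leq_addr ?leq_addl.
- by apply/st_classP; rewrite statE /= size_map.
- by apply/st_classP; rewrite statE /= size_map.
Qed.

Fact shuffle_mul_linearl b : linear (shuffle_mul^~ b).
Proof. by move=> c a a'; rewrite /shuffle_mul linearP. Qed.

Fact shuffle_mul_linearr a : linear (shuffle_mul a).
Proof.
move=> c b b'; rewrite /shuffle_mul /linext scaler_sumr -big_split.
apply: eq_bigr => k _ /=; rewrite -![\sum_(_ <- _) _]/(linext _ _) linearP.
by rewrite scalerDr !scalerA mulrC.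
Qed.

HB.instance Definition _ a := GRing.isLinear.Build rat {malg rat[st_class]}
  {malg rat[st_class]} *:%R (shuffle_mul a) (shuffle_mul_linearr a).

Fact shuffle_mulUU k l : shuffle_mul << k >> << l >> = class_mul k l.
Proof. by rewrite /shuffle_mul !linextU. Qed.

Fact shuffle_mulC : commutative shuffle_mul.
Proof.
move=> a b; apply: (malg_linear_ext (shuffle_mul_linearl b) (shuffle_mul_linearr b)).
move=> k {a}; apply: (malg_linear_ext (shuffle_mul_linearr _) (shuffle_mul_linearl _)).
move=> l {b}; rewrite !shuffle_mulUU.
have [pi [sigma [_ [[dj _ _] -> -> _]]]] := disjoint_reprs k l l.
have dj' : disjoint_perm sigma pi by rewrite disjoint_permC.
by rewrite !class_mulE //; apply/perm_big/shufflesC.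
Qed.

Fact shuffle_mulA : associative shuffle_mul.
Proof.
move=> a b c.
have lin3 x y : linear (fun z => shuffle_mul x (shuffle_mul y z)).
  by move=> u z z'; rewrite !linearP.
have lin2 x z : linear (fun y => shuffle_mul x (shuffle_mul y z)).
  by move=> u y y'; rewrite shuffle_mul_linearl linearP.
have lin1 y z : linear (fun x => shuffle_mul (shuffle_mul x y) z).
  by move=> u x x'; rewrite !shuffle_mul_linearl.
have lin2' x z : linear (fun y => shuffle_mul (shuffle_mul x y) z).
  by move=> u y y'; rewrite linearP shuffle_mul_linearl.
apply: (malg_linear_ext (shuffle_mul_linearl _) (lin1 _ _)) => k {a}.
apply: (malg_linear_ext (lin2 _ _) (lin2' _ _)) => l {b}.
apply: (malg_linear_ext (lin3 _ _) (shuffle_mul_linearr _)) => m {c}.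
have [pi [sigma [rho [[d1 d2 d3] -> -> ->]]]] := disjoint_reprs k l m.
rewrite !shuffle_mulUU !class_mulE // linear_sum [RHS]shuffle_mulC linear_sum /=.
transitivity (\sum_(w <- [seq w | tau <- shuffles sigma rho, w <- shuffles tau pi])
   (<< \pi_st_class w >> : {malg rat[st_class]})).
  rewrite big_allpairs_dep; apply: eq_big_seq => tau ht.
  rewrite shuffle_mulC shuffle_mulUU class_mulE //.
  by apply: (disjoint_perm_shuffle ht); rewrite disjoint_permC.
rewrite -(perm_big _ (shufflesA d1 d2 d3)) big_allpairs_dep.
apply: eq_big_seq => tau ht.
rewrite shuffle_mulC shuffle_mulUU class_mulE //.
exact: (disjoint_perm_shuffle ht).
Qed.

Fact shuffle_mul1 : left_id << \pi_st_class nil_perm >> shuffle_mul.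
Proof.
apply: (malg_linear_ext (shuffle_mul_linearr _)) => [? ? ? //|]; elim/quotW => pi.
rewrite shuffle_mulUU class_mulE ?shuffles_nil ?big_seq1 //.
by rewrite /disjoint_perm has_sym.
Qed.

Fact shuffle_one_neq0 : << \pi_st_class nil_perm >> != 0 :> {malg rat[st_class]}.
Proof. by rewrite monalgU_eq0 oner_eq0. Qed.

Fact shuffle_mulDl : left_distributive shuffle_mul +%R.
Proof. by move=> a b c; rewrite /shuffle_mul linearD. Qed.

Definition shuffle_algebra of shuffle_compatible st := {malg rat[st_class]}.

End ShuffleAlgebra.

Section ShuffleAlgebraInstances.
Variables (T : eqType) (st : statistic T) (st_compat : shuffle_compatible st).
Local Notation A := (shuffle_algebra st_compat).

HB.instance Definition _ := GRing.Lmodule.copy A {malg rat[st_class st]}.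
HB.instance Definition _ := GRing.Zmodule_isComNzRing.Build A
  (shuffle_mulA st_compat) (shuffle_mulC st_compat) (shuffle_mul1 st_compat)
  (@shuffle_mulDl _ st) (shuffle_one_neq0 st).

Fact shuffle_scaleAl (c : rat) (a b : A) : c *: (a * b) = (c *: a) * b.
Proof.
exact: esym (linearZ_LR
  (linext (fun k => linext (@class_mul _ st k) b) : {linear {malg rat[_]} -> _}) c a).
Qed.

HB.instance Definition _ := GRing.Lmodule_isLalgebra.Build rat A shuffle_scaleAl.
HB.instance Definition _ := GRing.Lalgebra_isComAlgebra.Build rat A.

Definition shuffle_class pi : A := << \pi_(st_class st) pi >> : {malg rat[st_class st]}.

Lemma shuffle_classM pi sigma : disjoint_perm pi sigma ->
  shuffle_class pi * shuffle_class sigma =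
  \sum_(tau <- shuffles pi sigma) shuffle_class tau.
Proof.
move=> dj; rewrite /shuffle_class.
by rewrite -[LHS]/(shuffle_mul _ _) shuffle_mulUU class_mulE.
Qed.

Lemma shuffle_class_nil : shuffle_class nil_perm = 1.
Proof. by []. Qed.

End ShuffleAlgebraInstances.

Section Span.
Variable V : lmodType rat.
Implicit Types X : set V.

Definition qspan X : set V :=
  [set v | exists s : seq (rat * V),
     (forall u, u \in s -> X u.2) /\ v = \sum_(u <- s) u.1 *: u.2].

Definition has_dim (U : set V) (d : nat) : Prop :=
  exists e : 'I_d -> V,
    (forall c : 'I_d -> rat, \sum_i c i *: e i = 0 -> forall i, c i = 0) /\
    qspan (range e) = U.

End Span.

Definition homogeneous_component (T : eqType) (st : statistic T)
    (st_compat : shuffle_compatible st) (n : nat) : set (shuffle_algebra st_compat) :=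
  qspan [set a | exists2 pi : permutation, size pi = n & a = shuffle_class st_compat pi].

Arguments homogeneous_component {T st} st_compat n.

(* Formal power series in t as coefficient sequences, with the Cauchy product. *)
Definition fps := nat -> rat.

HB.instance Definition _ := GRing.Zmodule.copy fps (nat -> rat).

Definition fps_one : fps := fun n => (n == 0%N)%:R.

Definition fps_mul (f g : fps) : fps :=
  fun n => \sum_(i < n.+1) f i * g (n - i)%N.

Definition fps_trunc (N : nat) (f : fps) : {poly rat} := \poly_(i < N.+1) f i.

Lemma fps_mul_trunc (N n : nat) (f g : fps) : (n <= N)%N ->
  fps_mul f g n = (fps_trunc N f * fps_trunc N g)`_n.
Proof.
move=> le; rewrite coefM; apply: eq_bigr => i _; rewrite !coef_poly.
rewrite !ltnS (leq_trans _ le) ?(leq_trans (leq_subr _ _) le) //.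
by rewrite -ltnS.
Qed.

Fact fps_mulA : associative fps_mul.
Proof.
move=> f g h; apply/funext => n; rewrite /fps_mul.
transitivity ((fps_trunc n f * (fps_trunc n g * fps_trunc n h))`_n).
  rewrite coefM; apply: eq_bigr => i _.
  rewrite -[\sum_(_ < _) _]/(fps_mul g h _) (fps_mul_trunc (N := n)) ?leq_subr //.
  by rewrite coef_poly ltn_ord.
rewrite mulrA coefM; apply: eq_bigr => i _.
rewrite -[\sum_(_ < _) _]/(fps_mul f g _) (fps_mul_trunc (N := n)) ?leq_ord //.
by rewrite coef_poly ltnS leq_subr.
Qed.

Fact fps_mulC : commutative fps_mul.
Proof.
move=> f g; apply/funext => n.
by rewrite !(fps_mul_trunc _ _ (leqnn n)) mulrC.
Qed.

Fact fps_mul1 : left_id fps_one fps_mul.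
Proof.
move=> f; apply/funext => n; rewrite /fps_mul big_ord_recl subn0 mul1r.
by rewrite big1 ?addr0 // => i _; rewrite mul0r.
Qed.

Fact fps_mulDl : left_distributive fps_mul +%R.
Proof.
move=> f g h; apply/funext => n; rewrite /fps_mul -[RHS]big_split /=.
by apply: eq_bigr => i _; rewrite -mulrDl.
Qed.

Fact fps_one_neq0 : fps_one != 0 :> fps.
Proof. by apply/eqP => /(congr1 (fun f : fps => f 0%N)). Qed.

HB.instance Definition _ := GRing.Zmodule_isComNzRing.Build fps
  fps_mulA fps_mulC fps_mul1 fps_mulDl fps_one_neq0.

(* The recurrence for the coefficients of the inverse of [f], when the
   constant coefficient of [f] is nonzero. *)
Fixpoint fps_inv_seq (f : fps) (n : nat) : seq rat :=
  if n is m.+1 then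
    let s := fps_inv_seq f m in
    rcons s (- (f 0%N)^-1 * \sum_(i < m.+1) f i.+1 * s`_(m - i))
  else [:: (f 0%N)^-1].

Definition fps_unit : {pred fps} := fun f => f 0%N != 0.

Definition fps_inv (f : fps) : fps :=
  if f \in fps_unit then fun n => (fps_inv_seq f n)`_n else f.

Fact size_fps_inv_seq f n : size (fps_inv_seq f n) = n.+1.
Proof. by elim: n => //= n IH; rewrite size_rcons IH. Qed.

Fact nth_fps_inv_seq f n m : (m <= n)%N ->
  (fps_inv_seq f n)`_m = (fps_inv_seq f m)`_m.
Proof.
elim: n => [|n IH]; first by rewrite leqn0 => /eqP->.
rewrite leq_eqVlt => /predU1P[->//|]; rewrite ltnS => le.
by rewrite /= nth_rcons size_fps_inv_seq ltnS le IH.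
Qed.

Fact fps_mulV : {in fps_unit, left_inverse 1 fps_inv *%R}.
Proof.
move=> f fu; have f0 : f 0%N != 0 by []; rewrite mulrC; apply/funext => n.
rewrite -[LHS]/(fps_mul f (fps_inv f) n) /fps_mul /fps_inv fu.
case: n => [|n]; first by rewrite big_ord1 subn0 /=; exact: mulfV.
rewrite -[RHS]/(0 : rat) big_ord_recl subn0 /= nth_rcons size_fps_inv_seq ltnn eqxx.
rewrite mulrA mulrN mulfV // mulN1r addrC; apply/eqP; rewrite subr_eq0; apply/eqP.
by apply: eq_bigr => i _; rewrite subSS -(nth_fps_inv_seq _ (leq_subr i n)).
Qed.

Fact fps_unitPl (f g : fps) : g * f = 1 -> f \in fps_unit.
Proof.
move=> /(congr1 (fun h : fps => h 0%N)).
rewrite -[(g * f) _]/(fps_mul g f _) /fps_mul big_ord1 => e.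
apply/eqP => f0; move: e; rewrite subn0 f0 mulr0 => /eqP.
by rewrite eq_sym oner_eq0.
Qed.

Fact fps_inv_out : {in [predC fps_unit], fps_inv =1 id}.
Proof. by move=> f; rewrite /fps_inv inE /= => /negPf->. Qed.

HB.instance Definition _ := GRing.ComNzRing_hasMulInverse.Build fps
  fps_mulV fps_unitPl fps_inv_out.

Definition fps_t : fps := fun n => (n == 1%N)%:R.

(* [hadamard] is Q[[t*]]: the pointwise product of coefficient sequences is the
   Hadamard product, whose unit is 1/(1-t). *)
Definition hadamard := nat -> rat.

HB.instance Definition _ := GRing.ComNzRing.copy hadamard (nat -> rat).

Definition hpoly := {poly hadamard}.

HB.instance Definition _ := GRing.ComNzRing.copy hpoly {poly hadamard}.

(* Rational scalars act on every coefficient: the scalar [c] is the sequence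
   constantly equal to [c], that is the series c/(1-t). *)
Definition hpoly_scale (c : rat) (p : hpoly) : hpoly :=
  ((fun=> c) : hadamard) *: (p : {poly hadamard}).

Fact hpoly_scaleA a b p : hpoly_scale a (hpoly_scale b p) = hpoly_scale (a * b) p.
Proof. exact: scalerA. Qed.

Fact hpoly_scale1 : left_id 1 hpoly_scale.
Proof. exact: scale1r. Qed.

Fact hpoly_scaleDr : right_distributive hpoly_scale +%R.
Proof. by move=> c; exact: scalerDr. Qed.

Fact hpoly_scaleDl p : {morph hpoly_scale^~ p : a b / a + b}.
Proof. by move=> a b; exact: (scalerDl (p : {poly hadamard})). Qed.

HB.instance Definition _ := GRing.Zmodule_isLmodule.Build rat hpoly
  hpoly_scaleA hpoly_scale1 hpoly_scaleDr hpoly_scaleDl.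

Fact hpoly_scaleAl (c : rat) (p q : hpoly) : c *: (p * q) = (c *: p) * q.
Proof. exact: (@scalerAl hadamard {poly hadamard}). Qed.

HB.instance Definition _ := GRing.Lmodule_isLalgebra.Build rat hpoly hpoly_scaleAl.
HB.instance Definition _ := GRing.Lalgebra_isComAlgebra.Build rat hpoly.

(* The element f x^n of Q[[t*]][x]. *)
Definition hmonomial (f : fps) (n : nat) : hpoly :=
  ((f : hadamard)%:P * 'X^n : {poly hadamard}).

(* For j <= n/2 the truncated subtraction in the exponent is exact. *)
Definition lpk_term (n j : nat) : hpoly :=
  hmonomial (2%:R ^+ (2 * j) * fps_t ^+ j * (1 + fps_t) ^+ (n - 2 * j)
             / (1 - fps_t) ^+ n.+1) n.

Definition lpk_generators : set hpoly :=
  [set hmonomial (1 / (1 - fps_t)) 0] `|`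
  [set p | exists n j, [/\ (1 <= n)%N, (j <= n./2)%N & p = lpk_term n j]].

(* Main.v *)
(* Cutting a word into 2k+1 consecutive blocks, alternately increasing and
   decreasing, amounts to choosing a left enriched partition of it bounded by k.
   The number [enriched_series w k] of such cuts is an iterated convolution, for
   deconcatenation, of the indicators of increasing and of decreasing words.
   These indicators are multiplicative for the shuffle product, and so are their
   convolutions, because deconcatenation is compatible with shuffles: hence
   w |-> [enriched_series w] sends shuffles to Hadamard products. Reading w from
   its first letter, the counts satisfy a recurrence that only sees the ascents
   and descents of w: in the numerator of the generating series in t, each
   maximal run of descents contributes 4t in place of two of the |w| factors
   1 + t, so the series depends only on |w| and lpk(w). As the series
   attached to lpk = j has order exactly j in t, distinct classes have linearly
   independent images, from which shuffle-compatibility, injectivity and the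
   dimensions all follow. *)
Require Import Defs.
From HB Require Import structures.
From mathcomp Require Import all_boot all_order all_algebra.
From mathcomp Require Import finmap.
From mathcomp Require Import boolp classical_sets functions.
From mathcomp Require Import monalg.
From mathcomp Require Import ring zify.

Set Implicit Arguments.
Unset Strict Implicit.
Unset Printing Implicit Defensive.

Import GRing.Theory.

Local Open Scope quotient_scope.
Local Open Scope classical_set_scope.
Local Open Scope ring_scope.

(** * Shuffles and deconcatenation *)

(** Unlike the filtered enumeration [shuffles], this recursion on the first letter of the shuffle
    supports induction; [perm_shuffles] identifies the two. *)
Fixpoint shuf (s : seq nat) : seq nat -> seq (seq nat) :=
  if s is a :: s' then
    fix shuf_s t :=
      if t is b :: t' then
        map (cons a) (shuf s' t) ++ map (cons b) (shuf_s t')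
      else [:: s]
  else fun t => [:: t].

Lemma shufs0 s : shuf s [::] = [:: s].
Proof. by case: s. Qed.

Lemma shuf_cons a s b t :
  shuf (a :: s) (b :: t) =
    map (cons a) (shuf s (b :: t)) ++ map (cons b) (shuf (a :: s) t).
Proof. by []. Qed.

Lemma uniq_cat_cons (T : eqType) (a b : T) s t : uniq ((a :: s) ++ b :: t) ->
  [/\ a != b, uniq (s ++ b :: t) & uniq ((a :: s) ++ t)].
Proof.
move=> U; split.
- by move: U => /= /andP[]; rewrite mem_cat inE; case: eqP; rewrite ?orbT.
- by move: U => /= /andP[].
- by move: U; rewrite -cat_rcons -cats1 -catA uniq_catCA /= => /andP[].
Qed.

Lemma perm_shuf s t w : w \in shuf s t -> perm_eq w (s ++ t).
Proof.
elim: s t w => [|a s IHs] t w; first by rewrite inE => /eqP->.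
elim: t w => [|b t IHt] w; first by rewrite inE cats0 => /eqP->.
rewrite shuf_cons mem_cat => /orP[] /mapP[u hu ->].
  by rewrite /= perm_cons IHs.
rewrite perm_sym -cat_rcons -cats1 -catA perm_catCA perm_sym /= perm_cons.
exact: IHt.
Qed.

Lemma subseq_shuf s t w : w \in shuf s t -> subseq s w && subseq t w.
Proof.
elim: s t w => [|a s IHs] t w; first by rewrite inE sub0seq => /eqP->/=.
elim: t w => [|b t IHt] w; first by rewrite inE => /eqP->; rewrite subseq_refl.
rewrite shuf_cons mem_cat => /orP[] /mapP[u hu ->].
  have /andP[h1 h2] := IHs _ _ hu.
  by rewrite (subseq_trans h2 (subseq_cons u a)) -cat1s -(cat1s a u) cat_subseq.
have /andP[h1 h2] := IHt _ hu.
by rewrite (subseq_trans h1 (subseq_cons u b)) -(cat1s b t) -(cat1s b u) cat_subseq.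
Qed.

(** As letters are distinct, the first letter of [w] heads at most one of [s] and [t], and is
    removed from that word. *)
Lemma mem_shuf s t w : uniq (s ++ t) -> size w = (size s + size t)%N ->
  subseq s w -> subseq t w -> w \in shuf s t.
Proof.
elim: w s t => [|c w IH] [|a s] [|b t] U; rewrite ?addn0 //=.
- move=> sz _ /= tw; rewrite inE eq_sym.
  by rewrite -(size_subseq_leqif (s1 := b :: t)) //= sz.
- move=> sz /= tw _; rewrite inE eq_sym.
  by rewrite -(size_subseq_leqif (s1 := a :: s)) //= sz.
move=> [sz] sw tw; have [nab Ua Ub] := uniq_cat_cons U.
rewrite -[X in _ \in X]shuf_cons mem_cat.
have [eca|nca] := eqVneq a c.
  move: sw tw; rewrite -eca eqxx [b == a]eq_sym (negPf nab) => sw tw.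
  by apply/orP; left; apply: map_f; apply: IH.
move: sw; rewrite (negPf nca) => sw.
have [ecb|ncb] := eqVneq b c.
  move: tw; rewrite -ecb eqxx => tw.
  by apply/orP; right; apply: map_f; apply: (IH (a :: s)); rewrite // sz /= addnS.
move: tw; rewrite (negPf ncb) => tw.
(* If it heads neither, the tail contains all the distinct letters of both words, for which it is
   too short. *)
have : (size ((a :: s) ++ (b :: t)) <= size w)%N.
  by apply: uniq_leq_size => // x; rewrite mem_cat => /orP[]; apply/mem_subseq.
by rewrite size_cat /= sz addSn ltnn.
Qed.

Lemma uniq_shuf s t : uniq (s ++ t) -> uniq (shuf s t).
Proof.
elim: s t => [|a s IHs] t //; elim: t => [|b t IHt] // U.
have [nab Ua Ub] := uniq_cat_cons U.
have inj c : injective (@cons nat c) by move=> ? ? [].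
rewrite shuf_cons cat_uniq !map_inj_uniq // (IHs _ Ua) (IHt Ub) /=.
rewrite andbT; apply/hasPn => _ /mapP[u _ ->]; apply/mapP => -[v _ [/eqP]].
by rewrite eq_sym (negPf nab).
Qed.

Lemma perm_shuffles pi sigma : disjoint_perm pi sigma ->
  perm_eq (map letters (shuffles pi sigma)) (shuf pi sigma).
Proof.
move=> dj; have U : uniq (pi ++ sigma).
  by rewrite cat_uniq !perm_uniq_letters /= andbT.
apply: uniq_perm; rewrite ?uniq_shuf //.
  by rewrite map_inj_uniq ?shuffles_uniq //; apply: val_inj.
move=> w; apply/mapP/idP => [[tau + ->]|hw].
  by rewrite mem_shuffles // => /and3P[/eqP sz s1 s2]; apply: mem_shuf.
have p := perm_shuf hw; have /andP[s1 s2] := subseq_shuf hw.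
have Pw : uniq w && all [pred a | 0 < a]%N w.
  rewrite (perm_uniq p) U; apply/allP => x; rewrite (perm_mem p) mem_cat.
  by case: (pi) (sigma) => s /= /andP[_ /allP hs] [t /= /andP[_ /allP ht]] /orP[/hs|/ht].
exists (Permutation Pw) => //; rewrite mem_shuffles //=.
by rewrite (perm_size p) size_cat eqxx s1.
Qed.

Lemma sum_shuffles (V : nmodType) (F : seq nat -> V) pi sigma :
  disjoint_perm pi sigma ->
  \sum_(tau <- shuffles pi sigma) F tau = \sum_(w <- shuf pi sigma) F w.
Proof. by move=> dj; rewrite -(perm_big _ (perm_shuffles dj)) big_map. Qed.

(** * Characters of the shuffle product *)

Definition shuffle_character (F : seq nat -> rat) : Prop :=
  forall s t, uniq (s ++ t) -> \sum_(w <- shuf s t) F w = F s * F t.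

Definition convolution (F G : seq nat -> rat) (w : seq nat) : rat :=
  \sum_(i < (size w).+1) F (take i w) * G (drop i w).

Lemma sum_splits_cons (V : nmodType) (H : seq nat -> seq nat -> V) a w :
  \sum_(i < (size (a :: w)).+1) H (take i (a :: w)) (drop i (a :: w)) =
  H [::] (a :: w) + \sum_(i < (size w).+1) H (a :: take i w) (drop i w).
Proof. by rewrite big_ord_recl. Qed.

(* Deconcatenation is multiplicative for the shuffle product. *)
Lemma sum_shuf_splits (V : nmodType) (H : seq nat -> seq nat -> V) s t :
  \sum_(w <- shuf s t) \sum_(i < (size w).+1) H (take i w) (drop i w) =
  \sum_(i < (size s).+1) \sum_(j < (size t).+1)
    \sum_(u <- shuf (take i s) (take j t))
    \sum_(v <- shuf (drop i s) (drop j t)) H u v.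
Proof.
elim: s t H => [|a s IHs] t H.
  rewrite big_seq1 big_ord1; apply: eq_bigr => j _.
  by rewrite !big_seq1.
elim: t H => [|b t IHt] H.
  rewrite big_seq1; apply: eq_bigr => i _.
  by rewrite big_ord1 !shufs0 !big_seq1.
rewrite shuf_cons big_cat !big_map /=.
under eq_bigr do rewrite sum_splits_cons.
under [X in _ + X]eq_bigr do rewrite sum_splits_cons.
rewrite !big_split /= (IHs (b :: t) (fun u => H (a :: u))) (IHt (fun u => H (b :: u))).
(* Cuts with an empty prefix form the term [i = j = 0] on the right. In the others the prefix starts
   with [a] or with [b]: one induction hypothesis for each. *)
rewrite addrACA [RHS]big_ord_recl [X in _ = X + _]big_ord_recl /= big_seq1.
rewrite -[\sum_(v <- _ ++ _) _]/(\sum_(v <- shuf (a :: s) (b :: t)) _).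
rewrite shuf_cons big_cat !big_map -!addrA; congr (_ + (_ + _)).
rewrite [X in _ + X]big_ord_recl /= addrCA; congr (_ + _).
  by apply: eq_bigr => j _; rewrite /= !big_seq1.
rewrite -big_split /=; apply: eq_bigr => i _.
rewrite [X in X + _]big_ord_recl [RHS]big_ord_recl /=.
rewrite shufs0 !big_seq1 -addrA; congr (_ + _).
rewrite -big_split /=; apply: eq_bigr => j _.
by rewrite big_cat !big_map.
Qed.

Lemma convolution_character F G : shuffle_character F -> shuffle_character G ->
  shuffle_character (convolution F G).
Proof.
move=> hF hG s t U; rewrite (sum_shuf_splits (fun u v => F u * G v)) big_distrl /=.
apply: eq_bigr => i _; rewrite big_distrr /=; apply: eq_bigr => j _.
have Ut : uniq (take i s ++ take j t).
  apply: subseq_uniq U; apply: cat_subseq; exact: take_subseq.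
have Ud : uniq (drop i s ++ drop j t).
  apply: subseq_uniq U; apply: cat_subseq; exact: drop_subseq.
under eq_bigr do rewrite -big_distrr /= hG //.
by rewrite -big_distrl /= hF // mulrACA.
Qed.

Lemma nil_character : shuffle_character (fun w => (w == [::])%:R).
Proof.
move=> [|a s] [|b t] _; rewrite ?shufs0 ?big_seq1 ?mulr1 ?mulr0 //=.
by rewrite big_cat !big_map !big1 // addr0.
Qed.

(** Two sorted words without common letters have exactly one sorted shuffle, their merge, while an
    unsorted factor leaves none. Only the head that comes first for [r] can start a sorted
    shuffle. *)
Lemma sorted_character (r : rel nat) : transitive r -> irreflexive r ->
  (forall a b, a != b -> r a b || r b a) ->
  shuffle_character (fun w => (sorted r w)%:R).
Proof.
move=> tr irr tot; elim=> [|a s IHs] t; first by rewrite big_seq1 mul1r.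
elim: t => [|b t IHt] U; first by rewrite big_seq1 mulr1.
have [nab Ua Ub] := uniq_cat_cons U.
have head x u v : \sum_(w <- shuf u v) (sorted r (x :: w))%:R =
   (all (r x) (u ++ v))%:R * \sum_(w <- shuf u v) (sorted r w)%:R :> rat.
  rewrite big_distrr /=; apply: eq_big_seq => w /perm_shuf/perm_all <-.
  by rewrite path_sortedE // -natrM mulnb.
rewrite shuf_cons big_cat !big_map !head IHs ?IHt //= !path_sortedE //.
rewrite !all_cat /=.
have sub x y u : r x y -> all (r y) u -> all (r x) u.
  by move=> rxy; apply: sub_all => z; apply: tr.
have /orP[rab|rba] := tot _ _ nab.
  have /negPf-> : ~~ r b a by apply/negP => /(tr _ _ _ rab); rewrite irr.
  rewrite rab /= mul0r addr0 -!natrM !mulnb; congr (_ %:R); congr nat_of_bool.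
  move: (sub _ _ t rab); case: (all (r b) t) => [->//|_]; last by rewrite !andbF.
  by rewrite andbT andbA.
have /negPf-> : ~~ r a b by apply/negP => /(tr _ _ _ rba); rewrite irr.
rewrite rba /= andbF mul0r add0r -!natrM !mulnb; congr (_ %:R); congr nat_of_bool.
move: (sub _ _ s rba); case: (all (r a) s) => [->//|_]; last by rewrite andbF.
by rewrite andbCA.
Qed.

(* Blocks are indexed from the right. The letters of a block share their image
   in 0 < -1 < 1 < ... < -k < k: they increase for an image [>= 0] (even index)
   and decrease for an image [< 0] (odd index). *)
Definition block_rel (m : nat) : rel nat := if odd m then gtn else ltn.

Fixpoint enriched (m : nat) : seq nat -> rat :=
  if m is m'.+1 then
    convolution (fun w => (sorted (block_rel m') w)%:R) (enriched m')
  else fun w => (w == [::])%:R.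

Lemma enriched_character m : shuffle_character (enriched m).
Proof.
elim: m => [|m IH]; first exact: nil_character.
apply: convolution_character IH; apply: sorted_character.
- rewrite /block_rel; case: odd => x y z /= h1 h2; last exact: ltn_trans h1 h2.
  exact: ltn_trans h2 h1.
- by rewrite /block_rel; case: odd => x /=; rewrite ltnn.
- by rewrite /block_rel; case: odd => x y /=; rewrite neq_ltn // orbC.
Qed.

(* The cuts into blocks [m], ..., 0 with a nonempty block [m]. *)
Definition enriched_at (m : nat) (w : seq nat) : rat :=
  \sum_(i < size w)
    (sorted (block_rel m) (take i.+1 w))%:R * enriched m (drop i.+1 w).

Lemma enriched_nil m : enriched m [::] = 1.
Proof. by elim: m => //= m IH; rewrite /convolution big_ord1 /= IH mulr1. Qed.

Lemma enrichedS m w : enriched m.+1 w = enriched m w + enriched_at m w.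
Proof.
by rewrite /= /convolution big_ord_recl take0 drop0 mul1r.
Qed.

Arguments enriched : simpl never.

Lemma enriched_at1 m a : enriched_at m [:: a] = 1.
Proof. by rewrite /enriched_at big_ord1 /= enriched_nil mulr1. Qed.

(** Block [m] either stops after [a], leaving [b :: w] to the lower blocks, or goes on to [b], which
    [block_rel m] must allow. *)
Lemma enriched_at_cons m a b w :
  enriched_at m (a :: b :: w) =
    enriched m (b :: w) + (block_rel m a b)%:R * enriched_at m (b :: w).
Proof.
rewrite /enriched_at big_ord_recl /= mul1r; congr (_ + _).
rewrite big_distrr /=; apply: eq_bigr => i _.
by rewrite mulrA -natrM mulnb.
Qed.

(** * Generating series of the cuts of a word *)

Definition first_descent (w : seq nat) : bool :=
  (1 < size w)%N && (nth 0 w 1 < nth 0 w 0)%N.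

(* The number of maximal decreasing runs of length at least 2, counted by their
   last descents; their first letters are the left peaks. *)
Fixpoint descent_runs (w : seq nat) : nat :=
  if w is _ :: w' then
    (descent_runs w' + (first_descent w && ~~ first_descent w'))%N
  else 0%N.

(** Prepending [a] to a word headed by [b] affects only these two letters: if [b < a], then [a]
    becomes a left peak and [b] ceases to be one if it was. In [lp], positions are counted from
    0. *)
Lemma lpk_descent_runs pi : lpk pi = descent_runs pi.
Proof.
pose lp (s : seq nat) k := (nth 0 s k.+1 < nth 0 s k)%N &&
  ((k == 0%N) || (nth 0 s k.-1 < nth 0 s k)%N).
have -> : lpk pi = (\sum_(k < (size pi).-1) lp pi k)%N.
  rewrite -[LHS]/(lpk_val pi) /lpk_val (iotaDl 1 0) count_map -sum1_count.
  rewrite -{1}[(size pi).-1]subn0 big_mkord big_mkcond; apply: eq_bigr => k _.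
  rewrite /= /is_left_peak /is_peak /letter /lp add1n /= ltn_ord.
  by case: (k : nat) => [|m] /=; rewrite ?orbF ?andbT //= andbC; case: ifP.
case: pi => s /= /andP[+ _].
elim: s => [|a s IH] /=; first by rewrite big_ord0.
case: s IH => [|b s] IH; first by rewrite big_ord0.
move=> /andP[+ U]; rewrite inE negb_or => /andP[nab _]; rewrite -IH //.
rewrite big_ord_recl /= {1}/lp /= andbT addnC /first_descent /=.
case: s {IH U} => [|c s] /=; first by rewrite !big_ord0 andbT.
rewrite !big_ord_recl /= /lp /= andbT.
move: nab; rewrite neq_ltn => /orP[ab|ba].
  by rewrite ab andbT [(b < a)%N]ltnNge (ltnW ab) /= addn0.
rewrite ba [(a < b)%N]ltnNge (ltnW ba) andbF add0n.
by rewrite addnAC; case: (c < b)%N; rewrite ?add0n ?addn0 // addnC.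
Qed.

Lemma fps_coefD (f g : fps) k : (f + g) k = f k + g k. Proof. by []. Qed.
Lemma fps_coefN (f : fps) k : (- f) k = - f k. Proof. by []. Qed.

Lemma fps_coef_tM (f : fps) k : (fps_t * f) k = if k is k'.+1 then f k' else 0.
Proof.
rewrite -[LHS]/(fps_mul fps_t f k) /fps_mul; case: k => [|k].
  by rewrite big_ord1 mul0r.
rewrite big_ord_recl mul0r add0r big_ord_recl mul1r subSS subn0 big1 ?addr0 //.
by move=> i _; rewrite mul0r.
Qed.

Lemma fps_coef_1BtM (f : fps) k :
  ((1 - fps_t) * f) k = if k is k'.+1 then f k - f k' else f 0%N.
Proof.
rewrite mulrBl mul1r fps_coefD fps_coefN fps_coef_tM.
by case: k => // ; rewrite subr0.
Qed.

Lemma geometric_series : (1 - fps_t) * (fun=> 1 : rat) = 1.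
Proof.
by apply/funext => k; rewrite fps_coef_1BtM; case: k => //= k; rewrite subrr.
Qed.

Lemma unit_1Bt : (1 - fps_t) \is a GRing.unit.
Proof. by apply/unitrPr; exists (fun=> 1 : rat); exact: geometric_series. Qed.

Lemma inv_1Bt : (1 - fps_t)^-1 = (fun=> 1) :> fps.
Proof. by apply: (mulrI unit_1Bt); rewrite mulrV ?unit_1Bt // geometric_series. Qed.

(* The shift of [odd_series] by one places the blocks 2k-1 and 2k, which are
   the two that [enriched_series] gains from order k-1 to k, at the same order. *)
Definition even_series (w : seq nat) : fps := fun k => enriched_at k.*2 w.
Definition odd_series (w : seq nat) : fps :=
  fun k => if k is k'.+1 then enriched_at k'.*2.+1 w else 0.
Definition enriched_series (w : seq nat) : fps := fun k => enriched k.*2.+1 w.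

(** The decreasing block [2k+1] must stop after [a], leaving [b :: w] to blocks [2k, ..., 0]; the
    increasing block [2k] may stop or go on, with the same total count. A descent exchanges the
    roles, for blocks [2k] and [2k-1]. *)
Lemma odd_series_ascent a b w : (a < b)%N ->
  odd_series [:: a, b & w] = fps_t * even_series [:: a, b & w].
Proof.
move=> ab; apply/funext => -[|k]; rewrite fps_coef_tM //=.
rewrite /even_series !enriched_at_cons /block_rel /= odd_double /= ab enrichedS.
by rewrite ltnNge ltnW // mul1r mul0r addr0.
Qed.

(** The even series of [[:: a, b & w]] has coefficients [enriched (2k+1) (b :: w)]. Multiplying by 1
    - t takes differences, which count the cuts whose first nonempty block is [2k] or [2k-1]; for a
    descent these are [2k-1] and [2k-2]. *)
Lemma even_series_ascent a b w : (a < b)%N ->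
  (1 - fps_t) * even_series [:: a, b & w] = even_series (b :: w) + odd_series (b :: w).
Proof.
move=> ab; apply/funext => k; rewrite fps_coef_1BtM fps_coefD.
rewrite /even_series /odd_series; case: k => [|k].
  by rewrite enriched_at_cons /block_rel /= ab mul1r add0r addr0.
rewrite !enriched_at_cons /block_rel doubleS /= !odd_double /= ab.
by rewrite !mul1r !enrichedS; ring.
Qed.

Lemma odd_series_descent a b w : (b < a)%N ->
  odd_series [:: a, b & w] = even_series [:: a, b & w].
Proof.
move=> ba; apply/funext => -[|k]; rewrite /odd_series /even_series.
  by rewrite enriched_at_cons /block_rel /= ltnNge ltnW // mul0r addr0.
rewrite !enriched_at_cons /block_rel doubleS /= odd_double /= ba !enrichedS.
by rewrite ltnNge ltnW // mul1r mul0r addr0.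
Qed.

Lemma even_series_descent a b w : (b < a)%N ->
  (1 - fps_t) * even_series [:: a, b & w] =
    fps_t * even_series (b :: w) + odd_series (b :: w).
Proof.
move=> ba; apply/funext => k; rewrite fps_coef_1BtM fps_coefD fps_coef_tM.
have /negPf nab : ~~ (a < b)%N by rewrite -leqNgt ltnW.
rewrite /even_series /odd_series; case: k => [|k].
  by rewrite enriched_at_cons /block_rel /= nab mul0r !addr0.
rewrite !enriched_at_cons /block_rel doubleS /= !odd_double /= nab.
by rewrite !mul0r !enrichedS; ring.
Qed.

Lemma enriched_series_cons a w :
  (1 - fps_t) * enriched_series (a :: w) = even_series (a :: w) + odd_series (a :: w).
Proof.
apply/funext => k; rewrite fps_coef_1BtM fps_coefD.
rewrite /even_series /odd_series /enriched_series; case: k => [|k].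
  by rewrite enrichedS add0r addr0.
by rewrite doubleS !enrichedS; ring.
Qed.

(** Up to powers of 1 - t, prepending a letter multiplies the even series by 1 + t if the first two
    steps agree, by 2t for a descent before an ascent, and by 2 for an ascent before a descent. A
    run thus yields 4t; one still open at the first letter lacks its 2, hence the factor on the
    left. A single letter behaves as an ascent. *)
Lemma even_series_eval w (n := size w) (j := descent_runs w) : w != [::] -> uniq w ->
  if first_descent w then
    [/\ odd_series w = even_series w, (2 * j <= n)%N &
        2%:R * (1 - fps_t) ^+ n * even_series w =
          2%:R ^+ (2 * j) * fps_t ^+ j * (1 + fps_t) ^+ (n - 2 * j)]
  else
    [/\ odd_series w = fps_t * even_series w, (2 * j < n)%N &
        (1 - fps_t) ^+ n * even_series w =
          2%:R ^+ (2 * j) * fps_t ^+ j * (1 + fps_t) ^+ (n - 2 * j).-1].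
Proof.
elim: w @n @j => [|a w IH] //= _ /andP[]; case: w IH => [|b w] IH.
  move=> _ _ /=; split=> //; last first.
    rewrite !expr0 !mulr1; apply/funext => k; rewrite fps_coef_1BtM.
    by case: k => [|k]; rewrite /even_series !enriched_at1 ?subrr.
  by apply/funext => -[|k]; rewrite fps_coef_tM //= /even_series !enriched_at1.
rewrite inE negb_or => /andP[nab _] U.
move: (IH isT U); set s := b :: w; set d := first_descent s.
have -> : first_descent (a :: s) = (b < a)%N by [].
set j := descent_runs s; set n := size s; move=> {}IH.
move: nab; rewrite neq_ltn => /orP[ab|ba].
  rewrite [(b < a)%N]ltnNge (ltnW ab) /= addn0 odd_series_ascent // exprSr -mulrA.
  rewrite even_series_ascent // -/s.
  case: d IH => -[-> le e]; split=> //; try lia.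
    transitivity (2%:R * (1 - fps_t) ^+ n * even_series s); first by ring.
    rewrite e; congr (_ * _ ^+ _); lia.
  transitivity ((1 - fps_t) ^+ n * even_series s * (1 + fps_t)); first by ring.
  rewrite e -[LHS]mulrA -exprSr; congr (_ * _ ^+ _); lia.
rewrite ba odd_series_descent // exprSr.
have -> : 2%:R * ((1 - fps_t) ^+ n * (1 - fps_t)) * even_series [:: a, b & w]
  = 2%:R * (1 - fps_t) ^+ n * (fps_t * even_series s + odd_series s).
  by rewrite -(even_series_descent _ ba); ring.
case: d IH => -[-> le e] /=; rewrite ?addn0 ?addn1; split=> //; try lia.
  transitivity (2%:R * (1 - fps_t) ^+ n * even_series s * (1 + fps_t)); first by ring.
  rewrite e -[LHS]mulrA -exprSr; congr (_ * _ ^+ _); lia.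
(* A new run starts: its 2t meets the 2 of the left-hand side. *)
have -> : (n.+1 - 2 * j.+1 = (n - 2 * j).-1)%N by lia.
transitivity (2%:R ^+ 2 * fps_t * ((1 - fps_t) ^+ n * even_series s)); first by ring.
rewrite e mulnS exprD [fps_t ^+ j.+1]exprS.
by move: (2%:R ^+ (2 * j)) (_ ^+ _.-1) => x y; ring.
Qed.

Definition lpk_series (n j : nat) : fps :=
  2%:R ^+ (2 * j) * fps_t ^+ j * (1 + fps_t) ^+ (n - 2 * j) / (1 - fps_t) ^+ n.+1.

Lemma double_descent_runs_le w : uniq w -> (2 * descent_runs w <= size w)%N.
Proof.
case: w => // a w U; have := even_series_eval (isT : a :: w != [::]) U.
by case: ifP => _ [_ le _] //; apply: ltnW.
Qed.

(** [enriched_series_cons] supplies the missing factor: 2 for an open run, 1 + t otherwise. *)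
Lemma enriched_series_lpk w : uniq w ->
  enriched_series w = lpk_series (size w) (descent_runs w).
Proof.
move=> U; have u n : (1 - fps_t) ^+ n \is a GRing.unit by rewrite unitrX ?unit_1Bt.
apply: (mulIr (u (size w).+1)); rewrite divrK //; case: w U => [|a w] U.
  rewrite !expr0 !mulr1 mulrC; apply/funext => k; rewrite fps_coef_1BtM.
  by rewrite /enriched_series; case: k => [|k]; rewrite !enriched_nil ?subrr.
rewrite [LHS]mulrC exprSr -[LHS]mulrA enriched_series_cons.
have := even_series_eval (isT : a :: w != [::]) U.
case: ifP => _ [-> le e].
  by rewrite -e -mulr2n -mulr_natl; ring.
transitivity ((1 - fps_t) ^+ size (a :: w) * even_series (a :: w) * (1 + fps_t)).
  by ring.
by rewrite e -[LHS]mulrA -exprSr prednK ?subn_gt0.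
Qed.

(** * The shuffle algebra of the left peak number *)

Lemma fps_coef0M (f g : fps) : (f * g) 0%N = f 0%N * g 0%N.
Proof. by rewrite -[LHS]/(fps_mul f g 0) /fps_mul big_ord1. Qed.

Lemma fps_coef0X (f : fps) n : (f ^+ n) 0%N = f 0%N ^+ n.
Proof. by elim: n => // n IH; rewrite !exprS fps_coef0M IH. Qed.

Lemma fps_coef_natM n (f : fps) k : (n%:R * f) k = n%:R * f k.
Proof.
rewrite !mulr_natl; elim: n => [|n IH]; first by rewrite !mulr0n.
by rewrite !mulrS fps_coefD IH.
Qed.

Lemma fps_coef_tXM (f : fps) j k :
  (fps_t ^+ j * f) k = if (k < j)%N then 0 else f (k - j)%N.
Proof.
elim: j k => [|j IH] k; first by rewrite mul1r subn0.
by rewrite exprS -mulrA fps_coef_tM; case: k.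
Qed.

Lemma lpk_series_coef n j k : (k <= j)%N ->
  lpk_series n j k = if k == j then 4%:R ^+ j else 0.
Proof.
move=> kj; rewrite /lpk_series -!mulrA exprM -[2%:R ^+ 2]natrX -natrX.
rewrite fps_coef_natM fps_coef_tXM; case: ltngtP kj => // [_|->] _.
  by rewrite mulr0.
rewrite subnn fps_coef0M fps_coef0X natrX -[in RHS](mulr1 (_ ^+ _)); congr (_ * _).
have e : (1 + fps_t) 0%N = 1 by rewrite fps_coefD /fps_t /= addr0.
by rewrite e expr1n mul1r -exprVn fps_coef0X inv_1Bt expr1n.
Qed.

Definition hcoef (p : hpoly) (n k : nat) : rat := (p : {poly hadamard})`_n k.

Lemma hcoef_hmonomial f m n k : hcoef (hmonomial f m) n k = if n == m then f k else 0.
Proof.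
by rewrite /hcoef /hmonomial coefCM coefXn; case: eqP; rewrite ?mulr1 ?mulr0.
Qed.

Lemma hcoef_lpk_term m j n k :
  hcoef (lpk_term m j) n k = if n == m then lpk_series m j k else 0.
Proof. exact: hcoef_hmonomial. Qed.

Lemma hcoef_sum (I : Type) (r : seq I) (c : I -> rat) (F : I -> hpoly) n k :
  hcoef (\sum_(i <- r) c i *: F i) n k = \sum_(i <- r) c i * hcoef (F i) n k.
Proof.
elim: r => [|i r IH]; first by rewrite !big_nil /hcoef coef0.
rewrite !big_cons -IH /hcoef coefD; congr (_ + _).
by rewrite -[c i *: F i]/(hpoly_scale _ _) /hpoly_scale coefZ.
Qed.

Lemma hmonomialM (f g : fps) m n :
  hmonomial f m * hmonomial g n = hmonomial (fun k => f k * g k) (m + n).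
Proof.
rewrite /hmonomial exprD -[LHS]/((_ * _ : {poly hadamard})) mulrACA; congr (_ * _).
by rewrite -polyCM.
Qed.

Lemma hmonomial_sum (I : eqType) (r : seq I) (F : I -> fps) n :
  hmonomial (fun k => \sum_(i <- r) F i k) n = \sum_(i <- r) hmonomial (F i) n.
Proof.
elim: r => [|i r IH].
  rewrite big_nil /hmonomial (_ : (fun k => _) = (0 : hadamard)) ?polyC0 ?mul0r //.
  by apply/funext => k; rewrite big_nil.
rewrite big_cons -IH /hmonomial -[RHS]mulrDl -polyCD; congr (_%:P * _).
by apply/funext => k; rewrite big_cons.
Qed.

Lemma hmonomial_geometric : hmonomial (1 / (1 - fps_t)) 0 = 1.
Proof.
by rewrite /hmonomial mulr1 div1r inv_1Bt.
Qed.

Lemma lpk_term00 : lpk_term 0 0 = hmonomial (1 / (1 - fps_t)) 0.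
Proof. by rewrite /lpk_term !expr0 !mulr1 expr1. Qed.

Lemma sum_shuffles_lpk_term pi sigma : disjoint_perm pi sigma ->
  \sum_(tau <- shuffles pi sigma) lpk_term (size tau) (lpk tau) =
  lpk_term (size pi) (lpk pi) * lpk_term (size sigma) (lpk sigma).
Proof.
move=> dj; have term (tau : permutation) : lpk_term (size tau) (lpk tau) =
    hmonomial (enriched_series tau) (size tau).
  by rewrite enriched_series_lpk ?perm_uniq_letters // -lpk_descent_runs.
rewrite !term hmonomialM.
transitivity (\sum_(tau <- shuffles pi sigma)
    hmonomial (enriched_series tau) (size pi + size sigma)).
  by apply: eq_big_seq => tau; rewrite mem_shuffles // term => /and3P[/eqP->].
(* Hadamard products are coefficientwise, so the claim at t^k is the character property of
   [enriched (2k+1)]. *)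
rewrite -hmonomial_sum; congr hmonomial; apply/funext => k.
rewrite (sum_shuffles (enriched k.*2.+1)) //; apply: enriched_character.
by rewrite cat_uniq !perm_uniq_letters /= andbT.
Qed.

Definition lpk_image (k : st_class lpk) : hpoly :=
  lpk_term (size (repr k)) (lpk (repr k)).

Lemma lpk_image_class pi :
  lpk_image (\pi_(st_class lpk) pi) = lpk_term (size pi) (lpk pi).
Proof.
rewrite /lpk_image; set sigma := repr _.
by have [-> ->] : size sigma = size pi /\ lpk sigma = lpk pi
  by apply/st_classP; rewrite /sigma reprK.
Qed.

(* The image of the class of left peak number [j] has order [j] in [t], which
   makes the images of distinct classes of the same length independent. *)
Lemma linext_lpk_image_inj : injective (linext lpk_image).
Proof.
apply: raddf_inj => a a0; apply/malgP => k; rewrite mcoeff0.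
pose j := lpk (repr k); have [m jm] : exists m, (j < m)%N by exists j.+1.
elim: m k @j jm => // m IH k j; rewrite ltnS => jm.
(* In the coefficient of t^j in this length, classes with fewer left peaks vanish by induction and
   those with more only have higher powers of t; [k] alone remains. *)
have := hcoef_sum (msupp a) (fun k => a@_k) lpk_image (size (repr k)) j.
rewrite -/(linext lpk_image a) a0 /hcoef coef0 => /esym.
have [ka|/mcoeff_outdom->//] := boolP (k \in msupp a).
rewrite (big_fsetD1 k) //= -/(hcoef _ _ _) hcoef_lpk_term eqxx lpk_series_coef // eqxx.
rewrite big1_seq ?addr0.
  by move=> /eqP; rewrite mulf_eq0 expf_eq0 andbF orbF => /eqP.
move=> l /=; rewrite !inE => /andP[nlk _].
rewrite -/(hcoef _ _ _) hcoef_lpk_term; case: eqP => [sz|_]; last by rewrite mulr0.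
case: (ltngtP (lpk (repr l)) j) => [lj|jl|e].
- by rewrite IH ?mul0r // (leq_trans lj).
- by rewrite lpk_series_coef ?(ltnW jl) // ltn_eqF // mulr0.
- case/eqP: nlk; rewrite -[l]reprK -[k]reprK; apply/st_classP.
  by split.
Qed.

(** Both sums of classes have the same image, so they agree in the free module, where injectivity
    holds before any product is available. Their coefficients are the multiplicities sought. *)
Lemma lpk_shuffle_compatible : shuffle_compatible lpk.
Proof.
move=> pi sigma pi' sigma' dj dj' sz sz' e e'.
have szs : {in shuffles pi sigma,
    forall tau : permutation, size tau = (size pi + size sigma)%N}.
  by move=> tau; rewrite mem_shuffles // => /and3P[/eqP].
have szs' : {in shuffles pi' sigma',
    forall tau : permutation, size tau = (size pi + size sigma)%N}.
  by move=> tau; rewrite mem_shuffles // sz sz' => /and3P[/eqP].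
have E : \sum_(tau <- shuffles pi sigma)
      (<< \pi_(st_class lpk) tau >> : {malg rat[st_class lpk]})
    = \sum_(tau <- shuffles pi' sigma') << \pi_(st_class lpk) tau >>.
  apply: linext_lpk_image_inj; rewrite !linear_sum /=.
  under eq_bigr do rewrite linextU lpk_image_class.
  under [RHS]eq_bigr do rewrite linextU lpk_image_class.
  by rewrite !sum_shuffles_lpk_term // sz sz' e e'.
apply/allP => v; rewrite -map_cat => /mapP[rho hrho ->] /=.
have szr : size rho == (size pi + size sigma)%N.
  by apply/eqP; move: hrho; rewrite mem_cat => /orP[/szs|/szs'].
have := congr1 (fun a : {malg rat[st_class lpk]} => a@_(\pi_(st_class lpk) rho)) E.
rewrite (coef_sum_class lpk rho szs) (coef_sum_class lpk rho szs') // szr => /eqP.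
by rewrite Num.Theory.eqr_nat.
Qed.

Section LpkIsomorphism.
Variable lpk_compat : shuffle_compatible lpk.
Local Notation A := (shuffle_algebra lpk_compat).
Local Notation class := (shuffle_class lpk_compat).

Definition lpk_iso : A -> hpoly := linext lpk_image.

Fact lpk_iso_is_linear : linear lpk_iso.
Proof. exact: linext_is_linear. Qed.

HB.instance Definition _ :=
  GRing.isLinear.Build rat A hpoly *:%R lpk_iso lpk_iso_is_linear.

Lemma lpk_iso_class pi : lpk_iso (class pi) = lpk_term (size pi) (lpk pi).
Proof. by rewrite /lpk_iso linextU lpk_image_class. Qed.

Fact lpk_iso_is_monoid_morphism : monoid_morphism lpk_iso.
Proof.
split=> [|a b].
  rewrite -(shuffle_class_nil lpk_compat) lpk_iso_class lpk_term00.
  exact: hmonomial_geometric.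
have linl (z : A) : linear (fun x : A => lpk_iso (x * z)).
  by move=> u x y; rewrite mulrDl -scalerAl linearP.
have linl' (z : hpoly) : linear (fun x : A => lpk_iso x * z).
  by move=> u x y; rewrite linearP mulrDl -scalerAl.
have linr (z : A) : linear (fun x : A => lpk_iso (z * x)).
  by move=> u x y; rewrite mulrDr -scalerAr linearP.
have linr' (z : hpoly) : linear (fun x : A => z * lpk_iso x).
  by move=> u x y; rewrite linearP mulrDr -scalerAr.
apply: (malg_linear_ext (linl b) (linl' _)) => k {a}.
apply: (malg_linear_ext (linr _) (linr' _)) => l {b}.
have [pi [sigma [_ [[dj _ _] -> -> _]]]] := disjoint_reprs k l l.
rewrite -/(class pi) -/(class sigma) shuffle_classM // linear_sum.
rewrite !lpk_iso_class -sum_shuffles_lpk_term //.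
by apply: eq_bigr => tau _; exact: lpk_iso_class.
Qed.

HB.instance Definition _ :=
  GRing.isMonoidMorphism.Build A hpoly lpk_iso lpk_iso_is_monoid_morphism.

End LpkIsomorphism.

(** * Attained left peak numbers, image and dimensions *)

Lemma lpk_le pi : (lpk pi <= (size pi)./2)%N.
Proof.
have := double_descent_runs_le (perm_uniq_letters pi).
by rewrite lpk_descent_runs mul2n geq_half_double.
Qed.

(** The witness is [j] descending pairs [b+2, b+1], with [b] growing, before an increasing word of
    length [m]. The lower bound [b] forces an ascent after each pair, so each is a run of its
    own. *)
Lemma exists_descent_runs j m b : exists w,
  [/\ uniq w, all (ltn b) w, size w = (2 * j + m)%N & descent_runs w = j].
Proof.
elim: j b => [|j IH] b.
  exists (iota b.+1 m); split; rewrite ?iota_uniq ?size_iota //.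
    by apply/allP => x; rewrite mem_iota => /andP[].
  elim: m b => // -[|m] IHm b //.
  rewrite -[RHS](IHm b.+1) -[LHS]/((descent_runs (iota b.+2 m.+1) + _)%N).
  by rewrite /first_descent /= ltnNge leqW // addn0.
have [w [U /allP bw sz e]] := IH b.+2.
have lt x : x \in w -> (b.+2 < x)%N by exact: bw.
exists [:: b.+2, b.+1 & w]; split.
- rewrite /= U inE eqn_leq ltnn /= andbT; apply/andP.
  by split; apply/negP => /lt; lia.
- by apply/allP => x; rewrite !inE => /or3P[/eqP->|/eqP->|/lt] /=; lia.
- by rewrite /= sz; lia.
- have nd : first_descent (b.+1 :: w) = false.
    rewrite /first_descent; case: (w) lt => //= c w' /(_ c (mem_head _ _)); lia.
  by rewrite [descent_runs _]/= nd /= /first_descent /= ltnSn e addn0 addn1.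
Qed.

Lemma exists_lpk n j : (j <= n./2)%N ->
  exists2 pi : permutation, size pi = n & lpk pi = j.
Proof.
rewrite geq_half_double => jn.
have [w [U pos sz e]] := exists_descent_runs j (n - 2 * j) 0.
have P : uniq w && all [pred a | 0 < a]%N w by rewrite U.
exists (Permutation P); last by rewrite lpk_descent_runs.
by rewrite sz subnKC // mul2n.
Qed.

Lemma lpk_generatorsE :
  lpk_generators = [set p | exists n j, (j <= n./2)%N /\ p = lpk_term n j].
Proof.
apply/seteqP; split=> p /=.
  move=> [->|[n [j [_ jn ->]]]]; last by exists n, j.
  by exists 0%N, 0%N; rewrite lpk_term00.
move=> [[|n] [j [jn ->]]]; last by right; exists n.+1, j.
by left; move: jn; rewrite leqn0 => /eqP->; rewrite lpk_term00.
Qed.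

Lemma range_qspan (U V : lmodType rat) (f : {linear U -> V}) (X : set V) :
  X `<=` range f -> qspan X `<=` range f.
Proof.
move=> Xf _ [s [+ ->]]; elim: s => [|[c v] s IH] sX.
  by exists 0 => //; rewrite big_nil linear0.
have [|a _ fa] := IH; first by move=> u us; apply: sX; rewrite inE us orbT.
have [b _ fb] := Xf _ (sX (c, v) (mem_head _ _)).
by exists (c *: b + a) => //; rewrite big_cons linearP fa fb.
Qed.

Lemma range_lpk_iso lpk_compat : range (@lpk_iso lpk_compat) = qspan lpk_generators.
Proof.
apply/seteqP; split=> [_ [a _ <-]|].
  exists [seq (a@_k, lpk_image k) | k <- msupp a]; split; last by rewrite big_map.
  move=> _ /mapP[k _ ->]; rewrite lpk_generatorsE.
  by exists (size (repr k)), (lpk (repr k)); rewrite lpk_le.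
apply: range_qspan => q; rewrite lpk_generatorsE => -[n [j [jn ->]]].
have [pi <- <-] := exists_lpk jn.
by exists (shuffle_class lpk_compat pi) => //; exact: lpk_iso_class.
Qed.

(** One permutation is chosen for each left peak number up to n/2; their classes are distinct basis
    elements and exhaust length [n] by [lpk_le]. *)
Lemma has_dim_homogeneous_component (lpk_compat : shuffle_compatible lpk) n :
  has_dim (homogeneous_component lpk_compat n) (n./2 + 1).
Proof.
have /choice[p pE] : forall i : 'I_(n./2 + 1),
    exists pi : permutation, size pi = n /\ lpk pi = i.
  move=> i; have [|pi ? ?] := @exists_lpk n i; last by exists pi.
  by have := ltn_ord i; rewrite {2}addn1.
exists (fun i => shuffle_class lpk_compat (p i)); split=> [c c0 i|].
  have := congr1 (fun a : {malg rat[st_class lpk]} => a@_(\pi_(st_class lpk) (p i))) c0.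
  rewrite mcoeff0 raddf_sum /= (bigD1 i) //= big1 ?addr0.
    by rewrite mcoeffZ mcoeffUU mulr1.
  move=> j nji; rewrite mcoeffZ mcoeffU; case: eqP => [|_]; last by rewrite mulr0.
  move=> /st_classP[_]; have [_ ->] := pE i; have [_ ->] := pE j.
  by move=> /val_inj /eqP; rewrite (negPf nji).
congr qspan; apply/seteqP; split=> a /=.
  by move=> [i _ <-]; exists (p i) => //; have [] := pE i.
move=> [pi sz ->]; have lt : (lpk pi < n./2 + 1)%N by rewrite addn1 ltnS -sz lpk_le.
exists (Ordinal lt) => //; have [sz' e] := pE (Ordinal lt).
by rewrite /shuffle_class; congr << _ >>; apply/st_classP; rewrite sz' sz e.
Qed.

Theorem theorem4p10 :
  shuffle_compatible lpk /\
  forall lpk_compat : shuffle_compatible lpk,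
    [/\ GRing.subalg_closed [in qspan lpk_generators],
        exists phi : {lrmorphism shuffle_algebra lpk_compat -> hpoly},
          [/\ forall pi : permutation,
                phi (shuffle_class lpk_compat pi) =
                  if (1 <= size pi)%N then
                    hmonomial (2%:R ^+ (2 * lpk pi) * fps_t ^+ (lpk pi)
                               * (1 + fps_t) ^+ (size pi - 2 * lpk pi)
                               / (1 - fps_t) ^+ (size pi).+1) (size pi)
                  else hmonomial (1 / (1 - fps_t)) 0,
              injective phi
            & range phi = qspan lpk_generators]
      & forall n : nat,
          has_dim (homogeneous_component lpk_compat n) (n./2 + 1)].
Proof.
split=> [|lpk_compat]; first exact: lpk_shuffle_compatible.
split; last exact: has_dim_homogeneous_component.
  (* The span is a subalgebra as the range of an algebra morphism. *)
  rewrite -(range_lpk_iso lpk_compat); split=> [|c x y|x y]; rewrite !inE.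
  - by exists 1 => //; rewrite rmorph1.
  - by move=> [a _ <-] [b _ <-]; exists (c *: a + b); rewrite ?linearP.
  - by move=> [a _ <-] [b _ <-]; exists (a * b); rewrite ?rmorphM.
exists (@lpk_iso lpk_compat); split=> [pi||].
- rewrite /= lpk_iso_class; case: ifP => // /negbT; rewrite -leqNgt leqn0 size_eq0.
  move=> /eqP pi0; rewrite -lpk_term00 lpk_descent_runs pi0 //.
- exact: linext_lpk_image_inj.
- exact: range_lpk_iso.
Qed.
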